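(* Let $k\geq 0$ and $t\geq 2$ be integers and let $T$ be a tournament with $n$ vertices and irregularity $i(T)\leq k$. If $n\geq 6t+5k$, then $\kappa_{s}^{*}(T)\geq t$; that is, $T$ is $\omega^{*}$-strongly connected for every $1\leq\omega\leq t$.
   Context: A tournament is a digraph in which each pair of distinct vertices is joined by exactly one arc. The irregularity $i(T)$ of a tournament $T$ is $\max_{x\in V(T)}|d^{+}(x)-d^{-}(x)|$, where $d^{+},d^{-}$ denote out- and in-degree. For distinct vertices $u,v$ of a digraph $D$, a strong $k^{*}$-container between $u$ and $v$ is a set of $k$ internally disjoint paths that are either all $(u,v)$-paths or all $(v,u)$-paths, whose union contains every vertex of $D$. $D$ is $k^{*}$-strongly connected if there is a strong $k^{*}$-container between every two distinct vertices of $D$. If $D$ is $1^{*}$-strongly connected, the strong spanning connectivity $\kappa_{s}^{*}(D)$ is the largest integer $k$ such that $D$ is $\omega^{*}$-strongly connected for all $1\leq\omega\leq k$. *)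

(* Defs.v *)
From mathcomp Require Import all_boot.
Set Implicit Arguments. Unset Strict Implicit. Unset Printing Implicit Defensive.

Definition is_tournament (T : finType) (arc : rel T) : Prop :=
  (forall x, ~~ arc x x) /\
  (forall x y, x != y -> (arc x y) (+) (arc y x)).

Definition outdeg (T : finType) (arc : rel T) (x : T) : nat := #|[set y | arc x y]|.
Definition indeg (T : finType) (arc : rel T) (x : T) : nat := #|[set y | arc y x]|.

Definition irregularity_le (T : finType) (arc : rel T) (k : nat) : Prop :=
  forall x, outdeg arc x <= indeg arc x + k /\ indeg arc x <= outdeg arc x + k.

Definition is_path (T : finType) (arc : rel T) (u v : T) (s : seq T) : bool :=
  [&& path arc u s, last u s == v & uniq (u :: s)].

(* interior vertices of the path u :: s (u and the final vertex removed) *)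
Definition interior (T : Type) (s : seq T) : seq T := take (size s).-1 s.

(* A strong w*-container between u and v: w pairwise distinct paths P_0..P_{w-1},
   either all (u,v)-paths or all (v,u)-paths, pairwise internally disjoint,
   whose union covers every vertex. Path i is the vertex sequence a :: P i. *)
Definition container_from (T : finType) (arc : rel T) (w : nat) (a b : T)
    (P : 'I_w -> seq T) : Prop :=
  [/\ forall i, is_path arc a b (P i),
      injective P,
      forall i j, i != j -> [disjoint interior (P i) & interior (P j)]
    & forall x : T, x = a \/ exists i, x \in P i].

Definition strong_container (T : finType) (arc : rel T) (w : nat) (u v : T) : Prop :=
  exists P : 'I_w -> seq T, container_from arc u v P \/ container_from arc v u P.

Definition k_strongly_connected (T : finType) (arc : rel T) (w : nat) : Prop :=
  forall u v : T, u != v -> strong_container arc w u v.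

(* Main.v *)
(** Given u and v, sort the other vertices by their arcs with u and v: A (from u, to v),
    B (from v, to u), C (common out-neighbours), D (common in-neighbours).  An arc x -> y
    from C to D, called a link, is the interior of both a (u,v)-path and a (v,u)-path.
    Take w - 1 disjoint links, or a maximal disjoint family if there are fewer.

    With w - 1 links, counting degrees shows that the tournament S on the remaining
    vertices is strong, hence has a Hamiltonian cycle.  Cutting it at a suitable arc gives the
    last path, in one direction or the other, unless the cycle alternates between A and B;
    it can then be modified into a Hamiltonian path of S with both ends in A or both in B.

    With fewer links, maximality forces A or B, say A, to have at least two vertices more than
    the number of single-vertex interiors that are still needed.  A Hamiltonian path of what
    lies outside A and the links is linked to u and v, through at most two vertices of A, and
    a Hamiltonian path of the rest of A may be cut anywhere into the missing interiors. *)

Require Import Defs.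
From mathcomp Require Import all_boot zify.

Set Implicit Arguments. Unset Strict Implicit. Unset Printing Implicit Defensive.

(** * Hamiltonian cycles, and Hamiltonian paths with prescribed ends *)

Lemma cycle_cut (T : eqType) (e : rel T) (s : seq T) x :
  uniq s -> cycle e s -> x \in s ->
  exists p, [/\ path e (next s x) p, last (next s x) p = x & perm_eq (next s x :: p) s].
Proof.
move=> us cs xs; have ys : next s x \in s by rewrite mem_next.
have [i p ep] := rot_to ys; exists p.
have urot : uniq (next s x :: p) by rewrite -ep rot_uniq.
split; last by rewrite -ep perm_rot.
  by move: cs; rewrite -(rot_cycle i) ep /= rcons_path => /andP[].
have := cycle_next us; rewrite -(rot_cycle i) ep /= rcons_path => /andP[_ /eqP].
exact: (can_inj (prev_next us)).
Qed.

(* A vertex outside a cycle that has arcs both from and to it can be inserted, so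
   otherwise the outside splits into vertices dominated by the cycle and vertices dominating
   it; an arc from the former to the latter can be inserted as a block. *)
Lemma camion_step (T : finType) (e : rel T) (S : {set T}) (s : seq T) :
  {in S &, forall x y, e x y || e y x} ->
  (forall Y : {set T}, Y \proper S -> Y != set0 ->
     exists x y, [/\ x \in S :\: Y, y \in Y & e x y]) ->
  uniq s -> {subset s <= S} -> cycle e s -> 0 < size s < #|S| ->
  exists s', [/\ uniq s', {subset s' <= S}, cycle e s' & size s < size s'].
Proof.
move=> tot str us sS cs /andP[s0 sltS].
have ins c q : c \in s -> q != [::] -> uniq q -> {subset q <= S} ->
    ~~ has (mem s) q -> path e c (rcons q (next s c)) ->
    exists s', [/\ uniq s', {subset s' <= S}, cycle e s' & size s < size s'].
  move=> cins q0 uq qS dq pq.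
  have [p [pp lp per]] := cycle_cut us cs cins.
  have pm := perm_mem per.
  exists ((next s c :: p) ++ q); split.
  - rewrite cat_uniq uq (perm_uniq per) us andbT /=.
    by apply/hasPn => z zq; rewrite pm; apply: (hasPn dq).
  - by move=> z; rewrite mem_cat pm => /orP[/sS|/qS].
  - by rewrite /= rcons_cat cat_path pp lp pq.
  - by rewrite size_cat (perm_size per); case: (q) q0 => //= *; lia.
pose R := S :\: [set x in s].
have inR z : (z \in R) = (z \in S) && (z \notin s) by rewrite !inE andbC.
case: (boolP [exists z in R, has (fun c => e c z && e z (next s c)) s]).
  case/exists_inP=> z; rewrite inR => /andP[zS zs] /hasP[c cins /andP[cz zc]].
  apply: (ins c [:: z]) => //=; rewrite ?cz ?zc ?orbF //.
  by move=> y; rewrite inE => /eqP->.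
rewrite negb_exists_in => /forall_inP noins.
have noins' z c : z \in R -> c \in s -> e c z -> ~~ e z (next s c).
  by move=> zR cins cz; have := noins z zR => /hasPn/(_ c cins); rewrite cz.
have closed z c : z \in R -> c \in s -> e c z -> {in s, forall c', e c' z && ~~ e z c'}.
  move=> zR cins cz; have [zS zs] : z \in S /\ z \notin s by move: zR; rewrite inR => /andP.
  have [p [pp lp per]] := cycle_cut us cs cins.
  (* Dominating [z] passes from each vertex of the cycle to its successor, hence all the way round
     from [c]. *)
  have cyc : cycle (fun a b => e a z ==> (e b z && ~~ e z b)) s.
    apply: cycle_from_next => // a ains; apply/implyP => az.
    have nz := noins' _ _ zR ains az; rewrite nz andbT.
    have nS : next s a \in S by rewrite sS // mem_next.
    by have := tot _ _ nS zS; rewrite (negbTE nz) orbF.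
  have [p' [pp' lp' per']] := cycle_cut us cyc cins.
  have nx : e (next s c) z && ~~ e z (next s c).
    by have := next_cycle cyc cins; rewrite cz.
  move=> c'; rewrite -(perm_mem per') => c'in.
  have : all (fun b => e b z && ~~ e z b) (next s c :: p').
    rewrite /= nx /=; elim: (p') (next s c) nx pp' => //= b q IH a /andP[az _].
    by rewrite az /= => /andP[bz pq]; rewrite bz; exact: IH pq.
  by move/allP/(_ _ c'in).
case es : s s0 => [//|c0 p0] _.
have c0s : c0 \in s by rewrite es mem_head.
rewrite -es;
set sset := [set x in s].
have ssub : sset \proper S.
  rewrite properEcard cardsE (card_uniqP us) sltS andbT.
  by apply/subsetP => x; rewrite inE => /sS.
have s0 : sset != set0 by apply/set0Pn; exists c0; rewrite inE.
have [y [c [yR cin yc]]] := str _ ssub s0.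
rewrite inE in cin.
(* [Y] holds the outside vertices not dominated by [c0], hence by no vertex of the cycle. An arc
   into [Y] from the rest of [S] thus starts at an outside vertex [x] dominated by the cycle, and
   the block [x], [y'] fits in after [c0]. *)
pose Y := [set z in R | ~~ e c0 z].
have yY : y \in Y.
  rewrite inE yR /=; apply/negP => c0y.
  by have := closed _ _ yR c0s c0y c cin; rewrite yc andbF.
have YS : Y \proper S.
  apply/properP; split; first by apply/subsetP=> z; rewrite !inE => /andP[/andP[]].
  by exists c0; [exact: sS | rewrite !inE c0s].
have Y0 : Y != set0 by apply/set0Pn; exists y.
have [x [y' [xSY y'Y xy']]] := str _ YS Y0.
have [y'R y'c0] : y' \in R /\ ~~ e c0 y' by move: y'Y; rewrite inE => /andP.
have [y'S y's] : y' \in S /\ y' \notin s by move: y'R; rewrite inR => /andP.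
have noin c1 : c1 \in s -> ~~ e c1 y'.
  move=> c1s; apply/negP => c1y'.
  by have /andP[] := closed _ _ y'R c1s c1y' _ c0s; rewrite (negbTE y'c0).
have xs : x \notin s by apply/negP => /noin; rewrite xy'.
have xS : x \in S by move: xSY; rewrite inE => /andP[].
have c0x : e c0 x by move: xSY; rewrite !inE (negbTE xs) xS /= andbT negbK.
have nS : next s c0 \in S by rewrite sS // mem_next.
apply: (ins c0 [:: x; y']) => //=.
- rewrite inE andbT; apply: contraNneq y'c0 => <-; exact: c0x.
- by move=> z; rewrite !inE => /orP[]/eqP->.
- by rewrite (negbTE xs) (negbTE y's).
- rewrite c0x xy' andbT /=.
  have := tot _ _ nS y'S; rewrite (negbTE (noin _ _)) ?mem_next //.
Qed.

(* Adding loops to [e] makes one-vertex sequences cycles, which starts the induction. *)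
Lemma camion (T : finType) (e : rel T) (S : {set T}) :
  {in S &, forall x y, x != y -> e x y || e y x} ->
  (forall Y : {set T}, Y \proper S -> Y != set0 ->
     exists x y, [/\ x \in S :\: Y, y \in Y & e x y]) ->
  1 < #|S| ->
  exists s, [/\ uniq s, s =i S & cycle e s].
Proof.
move=> tot str S1; pose e' x y := (x == y) || e x y.
have tot' : {in S &, forall x y, e' x y || e' y x}.
  move=> x y xS yS; rewrite /e'; case: eqVneq => //= xy.
  exact: tot.
have str' (Y : {set T}) : Y \proper S -> Y != set0 ->
     exists x y, [/\ x \in S :\: Y, y \in Y & e' x y].
  move=> YS Y0; have [x [y [xS yY xy]]] := str Y YS Y0.
  by exists x, y; rewrite /e' xy orbT.
have long n : n < #|S| ->
    exists s, [/\ uniq s, {subset s <= S}, cycle e' s & n < size s].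
  elim: n => [|n IH] nS.
    case/card_gt0P: (nS) => x xS; exists [:: x]; split=> //=; last by rewrite /e' eqxx.
    by move=> y; rewrite inE => /eqP->.
  have [s [us sS cs ns]] := IH (ltnW nS).
  case: (ltnP n.+1 (size s)) => [ns'|sn]; first by exists s.
  have [|s' [us' sS' cs' ss']] := camion_step tot' str' us sS cs.
    by rewrite (leq_ltn_trans sn nS) (leq_trans _ ns).
  by exists s'; split=> //; exact: leq_ltn_trans ns ss'.
have [|s [us sS cs ns]] := long #|S|.-1; first by lia.
have sE : s =i S.
  have [||_ eqS z] := uniq_min_size (s1 := s) (s2 := enum S) us.
  - by move=> z /sS; rewrite mem_enum.
  - by rewrite -cardE -(prednK (ltnW S1)).
  - by rewrite eqS mem_enum.
exists s; split=> //; apply: cycle_from_next => // x xs.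
(* A loop can be used only if [x] is its own successor, which forces a one-vertex cycle. *)
have := next_cycle cs xs; rewrite /e' => /orP[/eqP xn|//].
have [p [pp lp per]] := cycle_cut us cs xs; rewrite -xn in pp lp per.
have := perm_size per; case: p pp lp per => [|y p] /= _ lp per szs.
  by rewrite -szs -(prednK (ltnW S1)) ltnS in ns; lia.
by have := perm_uniq per; rewrite us cons_uniq -{1}lp mem_last.
Qed.

(* [u] only serves as a fresh vertex, with arcs to [st] and from [en], which closes the
   path into a Hamiltonian cycle. *)
Lemma hamiltonian_path_between (T : finType) (e : rel T) (X : {set T}) u (st en : pred T) :
  u \notin X -> X != set0 ->
  {in X &, forall x y, x != y -> e x y || e y x} ->
  {in X, forall x, st x || en x} ->
  (forall Y : {set T}, Y \subset X -> Y != set0 -> {in Y, forall y, ~~ st y} ->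
     exists x y, [/\ x \in X :\: Y, y \in Y & e x y]) ->
  (forall Y : {set T}, Y \subset X -> Y != set0 -> {in Y, forall y, ~~ en y} ->
     exists y x, [/\ y \in Y, x \in X :\: Y & e y x]) ->
  exists z s, [/\ uniq (z :: s), z :: s =i X, path e z s, st z & en (last z s)].
Proof.
move=> uX X0 tot se hst hen.
pose e' x y := if x == u then st y else if y == u then en x else e x y.
have e'E x y : x \in X -> y \in X -> e' x y = e x y.
  by move=> xX yX; rewrite /e' !(negbTE (memPn uX _ _)).
have neu x : x \in X -> (x == u) = false by move/(memPn uX)/negbTE.
have [|||s [us sE cs]] := camion (e := e') (S := u |: X).
- move=> x y; rewrite !inE => /orP[/eqP->|xX] /orP[/eqP->|yX]; rewrite ?eqxx //.
  + by move=> _; rewrite /e' eqxx neu //; exact: se.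
  + by move=> _; rewrite /e' eqxx neu // orbC; exact: se.
  + by rewrite !e'E //; exact: tot.
- move=> Y YX Y0; have [YsX [w wX wY]] := properP YX.
  have memY y : y \in Y -> (y == u) || (y \in X).
    by move=> yY; have := subsetP YsX y yY; rewrite !inE.
  case: (boolP (u \in Y)) => uY.
    case: (boolP [exists y in X :\: Y, en y]) => [/exists_inP[y yXY eny]|].
      have [yX yY] : y \in X /\ y \notin Y by move: yXY; rewrite !inE => /andP[].
      by exists y, u; rewrite !inE yX yY orbT /e' neu // eqxx.
    rewrite negb_exists_in => /forall_inP nen.
    (* Here nothing outside [Y] has an arc to [u], so the complement of [Y] in [X] contains no
       possible end; an arc leaving this complement is an arc into [Y]. *)
    have [||y [x [yXY xX' yx]]] := hen (X :\: Y) _ _ nen; first exact: subsetDl.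
      apply/set0Pn; exists w; move: wX; rewrite !inE wY => /orP[/eqP wu|->//].
      by rewrite wu uY in wY.
    move: yXY xX'; rewrite !inE => /andP[yY yX] /andP[].
    rewrite negb_and negbK => xY xX; rewrite xX orbF in xY.
    by exists y, x; rewrite !inE yY yX orbT e'E.
  have YX' : Y \subset X.
    apply/subsetP => y yY; have := memY y yY; case: eqP => //= yu.
    by rewrite yu (negbTE uY) in yY.
  case: (boolP [exists y in Y, st y]) => [/exists_inP[y yY sty]|].
    by exists u, y; rewrite !inE uY eqxx /e' eqxx.
  rewrite negb_exists_in => /forall_inP nst.
  have [x [y [xXY yY xy]]] := hst Y YX' Y0 nst.
  move: xXY; rewrite !inE => /andP[xY xX].
  by exists x, y; rewrite !inE xY xX orbT e'E // (subsetP YX').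
- by rewrite cardsU1 uX; move: X0; rewrite -card_gt0; lia.
have uin : u \in s by rewrite sE !inE eqxx.
have [i p ep] := rot_to uin.
have pE x : x \in u :: p = (x \in u |: X) by rewrite -ep mem_rot sE.
have /andP[unp up] : uniq (u :: p) by rewrite -ep rot_uniq.
have pX : p =i X.
  move=> x; have := pE x; rewrite !inE.
  by case: (eqVneq x u) => //= -> _; rewrite (negbTE uX) (negbTE unp).
move: cs; rewrite -(rot_cycle i) ep /=.
case: p {ep pE unp} up pX => [|z q] up pX /=.
  by case/set0Pn: X0 => x; rewrite -pX.
rewrite rcons_path => /and3P[uz pq lq]; exists z, q; split=> //.
- apply: (sub_in_path (P := mem X)) pq => [x y xX yX|]; first by rewrite e'E.
  by apply/allP => x; rewrite pX.
- by move: uz; rewrite /e' eqxx.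
- by move: lq; rewrite /e' neu ?eqxx // -pX mem_last.
Qed.

(** * Insertion of a vertex into a path, and alternating cycles *)

(** [x] goes just before its first out-neighbour in [s]: the vertex preceding that one is [z] or not
    an out-neighbour of [x], so it has an arc to [x]. *)
Lemma path_insert (T : eqType) (e : rel T) x z s :
  {in s, forall y, ~~ e x y -> e y x} -> e z x -> path e z s -> has (e x) s ->
  exists q, [/\ path e z q, last z q = last z s & perm_eq q (x :: s)].
Proof.
elim: s z => //= y s IH z nx zx /andP[zy ys].
case: (boolP (e x y)) => [xy _|/= xy hs].
  by exists [:: x, y & s]; rewrite /= zx xy ys.
have [||q [pq lq per]] := IH y _ _ ys hs.
- by move=> w ws; apply: nx; rewrite inE ws orbT.
- by apply: nx; rewrite ?mem_head.
exists (y :: q); rewrite /= zy; split=> //.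
by rewrite (perm_trans (y := y :: x :: s)) ?perm_cons // (perm_catCA [:: y] [:: x] s).
Qed.

(** If one of the first two vertices of [s] is not an out-neighbour of [x], it has an arc to [x],
    and an out-neighbour of [x] still follows it, so [path_insert] applies from there. *)
Lemma path_insert_or_jump (T : eqType) (e : rel T) x y s :
  {in s, forall y, ~~ e x y -> e y x} -> path e y s -> 1 < count (e x) s ->
  (exists q, [/\ path e y q, last y q = last y s & perm_eq q (x :: s)]) \/
  (exists y2 y3 s', [/\ s = [:: y2, y3 & s'], e x y2 & e x y3]).
Proof.
case: s => [//|y2 s] nx /= /andP[yy2 y2s].
have nx' : {in s, forall y, ~~ e x y -> e y x}.
  by move=> w ws; apply: nx; rewrite inE ws orbT.
have add2 q : perm_eq q (x :: s) -> perm_eq (y2 :: q) [:: x, y2 & s].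
  move=> per; rewrite (perm_trans (y := y2 :: x :: s)) ?perm_cons //.
  by rewrite (perm_catCA [:: y2] [:: x] s).
case: (boolP (e x y2)) => [xy2|nxy2] /= cnt; last first.
  left; have y2x : e y2 x by apply: nx; rewrite ?mem_head.
  have [|q [pq lq per]] := path_insert nx' y2x y2s.
    by rewrite has_count; lia.
  by exists (y2 :: q); rewrite /= yy2; split=> //; exact: add2.
case: s y2s nx' add2 nx cnt => [//|y3 s] /= /andP[y23 y3s] nx' add2 nx cnt.
case: (boolP (e x y3)) => [xy3|nxy3]; first by right; exists y2, y3, s.
have y3x : e y3 x by apply: nx'; rewrite ?mem_head.
have [|||q [pq lq per]] := path_insert (s := s) _ y3x.
- by move=> w ws; apply: nx'; rewrite inE ws orbT.
- exact: y3s.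
- by rewrite (negbTE nxy3) in cnt; rewrite has_count; lia.
left; exists [:: y2, y3 & q]; rewrite /= yy2 y23; split=> //; apply: add2.
rewrite (perm_trans (y := y3 :: x :: s)) ?perm_cons //.
by rewrite (perm_catCA [:: y3] [:: x] s).
Qed.

(* If some x can be inserted elsewhere in the path left after removing x from the cycle, the
   ends of the result are the two neighbours of x.  Otherwise each vertex of the cycle
   dominates the second and third after it, and c1 c2 c4 c5 ... c0 c3 is a path. *)
Lemma alternating_cycle (T : eqType) (e : rel T) (col : T -> bool) (s : seq T) :
  (forall x, ~~ e x x) -> (forall x y, x != y -> ~~ e x y -> e y x) ->
  uniq s -> 4 < size s -> cycle [rel x y | e x y && (col x != col y)] s ->
  {in s, forall x, 2 < count (e x) s} ->
  exists z q, [/\ path e z q, perm_eq (z :: q) s & col z = col (last z q)].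
Proof.
move=> irr tot us s4 cs deg; set alt := [rel x y | _] in cs.
have sub x p : path alt x p -> path e x p.
  by apply: sub_path => a b /andP[].
pose good := exists z q, [/\ path e z q, perm_eq (z :: q) s & col z = col (last z q)].
have step x y p : perm_eq [:: x, y & p] s -> cycle alt [:: x, y & p] ->
    good \/ (exists y2 y3 p', [/\ p = [:: y2, y3 & p'], e x y2 & e x y3]).
  move=> per /=; rewrite rcons_path => /and3P[/andP[xy cxy] ap /andP[lx clx]].
  have xs : x \in s by rewrite -(perm_mem per) mem_head.
  have ux : x \notin y :: p by have := perm_uniq per; rewrite us => /andP[].
  have [||[q [pq lq pe]]|//] := path_insert_or_jump (x := x) _ (sub _ _ ap).
  - move=> z zp; apply: tot; apply: contraNneq ux => ->.
    by rewrite inE zp orbT.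
  (* Of the at least three out-neighbours of [x], one is [y] and none is [x], so two lie in [p]. *)
  - by have := deg x xs; rewrite -(permP per) /= (negbTE (irr x)) xy.
  - left; exists y, q; split=> //; last first.
      by rewrite lq; move: cxy clx => /=; case: (col x) (col y) (col (last y p)) => [] [] [].
    apply: perm_trans per; rewrite (perm_trans (y := [:: y, x & p])) ?perm_cons //.
    by rewrite (perm_catCA [:: y] [:: x] p).
  - by right.
case: s us cs deg s4 @good step => [|c0 [|c1 [|c2 [|c3 [|c4 p]]]]] // us cs deg _ good step.
have [//|[y2 [y3 [p' [[_ <- _] _ c03]]]]] := step _ _ _ (perm_refl _) cs.
set s := [:: c0, c1, c2, c3, c4 & p] in us deg good step.
have rotE : [:: c2, c3, c4 & p ++ [:: c0; c1]] = rot 2 s by rewrite /rot /s /= ?drop0 ?take0.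
have [||//|[y2' [y3' [p'' [[<- _] c24 _]]]]] := step c2 c3 (c4 :: p ++ [:: c0; c1]).
- by rewrite rotE perm_rot.
- by rewrite rotE rot_cycle.
move: cs => /= /and5P[/andP[c01 d01] /andP[c12 d12] /andP[c23 d23] _].
rewrite rcons_path => /andP[cp /andP[lp _]].
exists c1, ([:: c2, c4 & p] ++ [:: c0; c3]); split.
- by rewrite cat_path /= c12 c24 (sub _ _ cp) lp c03.
- rewrite /s; apply/permP => a /=; rewrite count_cat /= addn0.
  by move: (count a p) (a c0 : nat) (a c1 : nat) (a c2 : nat) (a c3 : nat) (a c4 : nat); clear; lia.
(* [c1] and [c3] are the two neighbours of [c2] on the cycle, so they have the same colour. *)
- by rewrite last_cat /=; move: d12 d23; case: (col c1) (col c2) (col c3) => [] [] [].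
Qed.

(** * Degrees in tournaments *)

(** Reversing all arcs exchanges in-degrees with out-degrees and starts of paths with ends, so each
    dual statement comes for free. *)
Definition converse (T : Type) (arc : rel T) : rel T := fun x y => arc y x.

Lemma tournament_converse (T : finType) (arc : rel T) :
  is_tournament arc -> is_tournament (converse arc).
Proof.
by case=> irr tot; split=> // x y xy; rewrite /converse addbC; apply: tot.
Qed.

Lemma tournament_arcVE (T : finType) (arc : rel T) x y :
  is_tournament arc -> x != y -> arc y x = ~~ arc x y.
Proof. by case=> _ tot xy; have := tot x y xy; case: (arc x y); case: (arc y x). Qed.

(** Averaging: inside [X] the in-degrees and the out-degrees have the same sum, and at each vertex
    the two add up to [#|X| - 1], so the in-degrees cannot all reach half of [#|X|]. *)
Lemma low_indeg (T : finType) (arc : rel T) (X : {set T}) :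
  is_tournament arc -> X != set0 ->
  exists2 x, x \in X & #|[set y in X | arc y x]|.*2 < #|X|.
Proof.
move=> tour /set0Pn[x0 x0X]; apply/exists_inP.
apply: contraT; rewrite negb_exists_in => /forall_inP high.
have cardE (P : pred T) : #|[set y in X | P y]| = \sum_(y in X) P y.
  by rewrite -sum1dep_card big_mkcondr; apply: eq_bigr => y _; case: (P y).
have inE' : \sum_(x in X) #|[set y in X | arc y x]| = \sum_(x in X) #|[set y in X | arc x y]|.
  rewrite (eq_bigr (fun x => \sum_(y in X) arc y x)) => [|x _]; last exact: cardE.
  by rewrite exchange_big; apply: eq_bigr => x _; rewrite cardE.
have sumE : \sum_(x in X) (#|[set y in X | arc y x]| + #|[set y in X | arc x y]|).+1
    = \sum_(x in X) #|X|.
  apply: eq_bigr => x xX; rewrite (cardsD1 x X) xX add1n; congr _.+1.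
  rewrite -cardsUI (_ : _ :&: _ = set0) ?cards0 ?addn0.
    apply: eq_card => y; rewrite !inE; case: (eqVneq y x) => [->|yx] /=.
      by rewrite (negbTE (proj1 tour x)) andbF.
    by rewrite -andb_orr (tournament_arcVE tour yx) orbN andbT.
  apply/setP => y; rewrite !inE; case: (eqVneq y x) => [->|yx] /=.
    by rewrite (negbTE (proj1 tour x)) andbF.
  by rewrite (tournament_arcVE tour yx) andbACA andbN andbF.
have leS : \sum_(x in X) #|X| <= \sum_(x in X) #|[set y in X | arc y x]|.*2.
  by apply: leq_sum => x xX; have := high x xX; rewrite -leqNgt.
have dblE : \sum_(x in X) #|[set y in X | arc y x]|.*2
    = \sum_(x in X) (#|[set y in X | arc y x]| + #|[set y in X | arc x y]|).
  by under eq_bigr do rewrite -addnn; rewrite big_split /= {2}inE' -big_split.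
move: leS; rewrite dblE -sumE; under eq_bigr do rewrite -addn1.
rewrite big_split /= sum1_card -[leqRHS]addn0 leq_add2l leqn0 cards_eq0 => /eqP X0.
by rewrite X0 inE in x0X.
Qed.

Lemma low_outdeg (T : finType) (arc : rel T) (X : {set T}) :
  is_tournament arc -> X != set0 ->
  exists2 x, x \in X & #|[set y in X | arc x y]|.*2 < #|X|.
Proof. by move/tournament_converse; exact: low_indeg. Qed.

Lemma outdeg_indeg (T : finType) (arc : rel T) x :
  is_tournament arc -> (outdeg arc x + indeg arc x).+1 = #|T|.
Proof.
move=> tour; rewrite -cardsT (cardsD1 x [set: T]) inE add1n; congr _.+1.
rewrite /outdeg /indeg -cardsUI (_ : _ :&: _ = set0) ?cards0 ?addn0.
  apply: eq_card => y; rewrite !inE; case: (eqVneq y x) => [->|yx] /=.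
    by rewrite (negbTE (proj1 tour x)).
  by rewrite (tournament_arcVE tour yx) orNb.
apply/setP => y; rewrite !inE; case: (eqVneq y x) => [->|yx] /=.
  by rewrite (negbTE (proj1 tour x)).
by rewrite (tournament_arcVE tour yx) andNb.
Qed.

(** * From lists of interiors to containers *)

Lemma flatten_uniq_nth (T : eqType) (Q : seq (seq T)) i j x :
  uniq (flatten Q) -> x \in nth [::] Q i -> x \in nth [::] Q j -> i = j.
Proof.
have mem_fl (R : seq (seq T)) k : x \in nth [::] R k -> x \in flatten R.
  case: (ltnP k (size R)) => [kR xk|/(nth_default _)->//].
  by apply/flattenP; exists (nth [::] R k); rewrite ?mem_nth.
elim: Q i j => [|q Q IH] i j; first by rewrite !nth_nil.
rewrite /= cat_uniq => /and3P[_ /hasPn nq uQ].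
case: i j => [|i] [|j] //= xi xj.
- by have := nq x (mem_fl _ _ xj); rewrite /= xi.
- by have := nq x (mem_fl _ _ xi); rewrite /= xj.
- by rewrite (IH i j).
Qed.

(** With the interiors listed in [Q], disjointness and covering become statements about [flatten Q].
    Nonempty disjoint interiors are distinct, which gives injectivity. *)
Lemma container_of_interiors (T : finType) (arc : rel T) (a b : T) (Q : seq (seq T)) :
  a != b -> 0 < size Q -> uniq (flatten Q) ->
  (forall x, (x \in flatten Q) = (x != a) && (x != b)) ->
  {in Q, forall q, q != [::] /\ path arc a (rcons q b)} ->
  exists P : 'I_(size Q) -> seq T, container_from arc a b P.
Proof.
move=> ab Q0 uQ memQ pQ.
pose q (i : 'I_(size Q)) := nth [::] Q i.
have qQ i : q i \in Q by rewrite mem_nth.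
have intq i : interior (rcons (q i) b) = q i.
  by rewrite /interior size_rcons /= -cats1 take_size_cat.
have sub i x : x \in q i -> (x != a) && (x != b).
  by move=> xq; rewrite -memQ; apply/flattenP; exists (q i).
exists (fun i => rcons (q i) b); split.
- move=> i; have [_ pq] := pQ _ (qQ i); apply/and3P; split=> //.
    by rewrite last_rcons.
  rewrite /= mem_rcons inE negb_or ab rcons_uniq /=.
  apply/and3P; split.
  + by apply/negP => /sub; rewrite eqxx.
  + by apply/negP => /sub; rewrite eqxx andbF.
  + have := qQ i; move: uQ; elim: (Q) => //= r R IH; rewrite cat_uniq inE.
    by case/and3P=> ur _ uR /orP[/eqP->|/IH->].
- move=> i j /rcons_inj[qij]; apply: val_inj.
  have [] := pQ _ (qQ i); case E: (q i) => [//|x r] _ _.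
  by apply: (flatten_uniq_nth (x := x)) uQ _ _; rewrite -/(q i) -/(q j) -?qij E mem_head.
- move=> i j ij; rewrite !intq disjoint_has; apply: contraNN ij => /hasP[x xi xj].
  by apply/eqP/val_inj; exact: (flatten_uniq_nth uQ xi xj).
- move=> x; case: (eqVneq x a) => [->|xa]; [by left|right].
  case: (eqVneq x b) => [->|xb]; first by exists (Ordinal Q0); rewrite mem_rcons mem_head.
  have /flattenP[r rQ xr] : x \in flatten Q by rewrite memQ xa xb.
  have ir : index r Q < size Q by rewrite index_mem.
  by exists (Ordinal ir); rewrite mem_rcons inE /q /= nth_index // xr orbT.
Qed.

(** The first [p.-1] vertices become one-vertex interiors and the rest of the path is the last one.
    Any cut is allowed, as every vertex has arcs from [a] and to [b]. *)
Lemma split_path (T : eqType) (e : rel T) a b p s :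
  sorted e s -> {in s, forall x, e a x /\ e x b} -> 0 < p <= size s ->
  exists Q, [/\ size Q = p, flatten Q = s
    & {in Q, forall q, q != [::] /\ path e a (rcons q b)}].
Proof.
elim: p s => // p IH [//|x s] /= ps ab psz.
have last_b y q : path e y q -> {subset y :: q <= x :: s} -> path e a (rcons (y :: q) b).
  move=> pq sub /=; rewrite rcons_path pq (proj1 (ab _ (sub _ (mem_head _ _)))).
  by rewrite (proj2 (ab _ (sub _ (mem_last _ _)))).
case: p IH psz => [|p] IH psz.
  by exists [:: x :: s]; rewrite /= cats0; split=> // q; rewrite inE => /eqP->; rewrite last_b.
have [||//|Q [sQ fQ pQ]] := IH s.
- exact: path_sorted ps.
- by move=> y ys; apply: ab; rewrite inE ys orbT.
exists ([:: x] :: Q); rewrite /= sQ fQ; split=> // q; rewrite inE => /orP[/eqP->|/pQ//].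
by split=> //; apply: last_b => // y; rewrite inE => /eqP->; rewrite mem_head.
Qed.

(** * Links, and the classes of vertices relative to [u] and [v] *)

(** A link is stored as a two-element list, ready to serve as an interior; disjointness of the links
    is expressed separately by [uniq (flatten M)]. *)
Definition links (T : finType) (arc : rel T) (C D : {set T}) (M : seq (seq T)) :=
  {in M, forall q, exists x y, [/\ q = [:: x; y], x \in C, y \in D & arc x y]}.

Lemma links_count (T : finType) (arc : rel T) (C D : {set T}) (M : seq (seq T)) :
  [disjoint C & D] -> links arc C D M ->
  [/\ size (flatten M) = (size M).*2, count (mem C) (flatten M) = size M
    & count (mem D) (flatten M) = size M].
Proof.
move=> dCD; elim: M => //= q M IH lM.
have [|sM cM dM] := IH; first by move=> r rM; apply: lM; rewrite inE rM orbT.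
have [x [y [-> xC yD _]]] := lM q (mem_head _ _).
rewrite /= sM cM dM xC yD.
by rewrite (disjointFr dCD xC) (disjointFl dCD yD).
Qed.

(** Greedy choice: links avoiding the earlier ones are added until there are [m] of them or none is
    left. *)
Lemma exists_links (T : finType) (arc : rel T) (C D : {set T}) m :
  [disjoint C & D] ->
  exists M, [/\ links arc C D M, uniq (flatten M), size M <= m
    & size M = m \/ (forall x y, x \in C -> y \in D -> x \notin flatten M ->
        y \notin flatten M -> ~~ arc x y)].
Proof.
move=> dCD; elim: m => [|m [M [lM uM sM mM]]]; first by exists [::]; split=> //; left.
case: mM => [smM|mM]; last by exists M; split=> //; [exact: leqW | right].
pose P x := (x \in C) && (x \notin flatten M).
pose P' y := (y \in D) && (y \notin flatten M).
case: (boolP [exists x, [exists y, [&& P x, P' y & arc x y]]]); last first.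
  move=> ne; exists M; split=> //; first exact: leqW.
  right=> x y xC yD xM yM; apply: contraNN ne => xy.
  by apply/existsP; exists x; apply/existsP; exists y; rewrite /P /P' xC yD xM yM.
case/existsP=> x /existsP[y /and3P[/andP[xC xM] /andP[yD yM] xy]].
exists ([:: x; y] :: M); split; last by left; rewrite /= smM.
- by move=> q; rewrite inE => /orP[/eqP->|/lM//]; exists x, y.
- rewrite /= inE negb_or xM yM uM !andbT.
  by apply: contraTneq yD => <-; rewrite (disjointFr dCD).
- by rewrite /= smM.
Qed.

Lemma card_set_count (T : finType) (P : pred T) (s : seq T) :
  uniq s -> #|[set x in s | P x]| = count P s.
Proof.
move=> us; rewrite -size_filter -(card_uniqP (filter_uniq P us)).
by apply: eq_card => x; rewrite inE mem_filter andbC.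
Qed.

(** Redei's theorem, by inserting vertices one at a time: in front, by [path_insert], or at the end
    when no vertex of the path is an out-neighbour. *)
Lemma redei (T : finType) (arc : rel T) (X : {set T}) :
  is_tournament arc -> exists s, [/\ uniq s, s =i X & sorted arc s].
Proof.
move=> tour; have tot x y : x != y -> ~~ arc x y -> arc y x.
  by move=> xy; rewrite (tournament_arcVE tour xy).
suff [s [per ss]] : exists s, perm_eq s (enum X) /\ sorted arc s.
  by exists s; rewrite (perm_uniq per) enum_uniq; split=> // x; rewrite (perm_mem per) mem_enum.
elim: (enum X) (enum_uniq X) => [|x l IH] /=; first by exists [::].
case/andP=> xl /IH[s [per ss]].
case: s per ss => [|z s] per ss.
  by exists [:: x]; rewrite perm_cons.
have xs y : y \in z :: s -> x != y.
  by rewrite (perm_mem per) => yl; apply: contraNneq xl => ->.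
case: (boolP (arc x z)) => [xz|nxz]; first by exists [:: x, z & s]; rewrite perm_cons /= xz.
have zx := tot _ _ (xs _ (mem_head _ _)) nxz.
have nx : {in s, forall y, ~~ arc x y -> arc y x}.
  by move=> y ys; apply: tot; rewrite xs // inE ys orbT.
have perx q : perm_eq q (x :: s) -> perm_eq (z :: q) (x :: l).
  move=> pq; rewrite (perm_trans (y := [:: x, z & s])) ?perm_cons //.
  by rewrite -(perm_cons z) in pq; rewrite (perm_trans pq) // (perm_catCA [:: z] [:: x] s).
case: (boolP (has (arc x) s)) => hs.
  have [q [pq _ perq]] := path_insert nx zx ss hs.
  by exists (z :: q); split=> //; exact: perx.
exists (z :: rcons s x); rewrite perx ?perm_rcons //; split=> //=.
rewrite rcons_path; apply/andP; split; first exact: ss.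
have := mem_last z s; rewrite inE => /orP[/eqP->//|ls].
by apply: nx => //; apply: (hasPn hs).
Qed.

(** These are the classes C, D and A of the overview; B is [between arc v u]. *)
Definition common_out (T : finType) (arc : rel T) u v := [set z | arc u z && arc v z].
Definition common_in (T : finType) (arc : rel T) u v := [set z | arc z u && arc z v].
Definition between (T : finType) (arc : rel T) u v := [set z | arc u z && arc z v].

Lemma common_outC (T : finType) (arc : rel T) u v : common_out arc u v = common_out arc v u.
Proof. by apply/setP => z; rewrite !inE andbC. Qed.

Lemma common_inC (T : finType) (arc : rel T) u v : common_in arc u v = common_in arc v u.
Proof. by apply/setP => z; rewrite !inE andbC. Qed.

Lemma common_disjoint (T : finType) (arc : rel T) u v :
  is_tournament arc -> [disjoint common_out arc u v & common_in arc u v].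
Proof.
move=> tour; apply/pred0P => z /=; rewrite !inE; apply/negP => /andP[/andP[uz _] /andP[zu _]].
have [zu'|zu'] := eqVneq u z; first by rewrite zu' (negbTE (proj1 tour z)) in uz.
by rewrite (tournament_arcVE tour zu') uz in zu.
Qed.

Lemma links_path (T : finType) (arc : rel T) u v M :
  links arc (common_out arc u v) (common_in arc u v) M ->
  {in M, forall q, q != [::] /\ path arc u (rcons q v)}.
Proof.
move=> lM q /lM[x [y [-> xC yD xy]]]; move: xC yD; rewrite !inE /=.
by case/andP=> -> _ /andP[_ ->]; rewrite xy.
Qed.

Lemma links_out (T : finType) (arc : rel T) u v M z :
  is_tournament arc -> links arc (common_out arc u v) (common_in arc u v) M ->
  z \in flatten M -> (z != u) && (z != v).
Proof.
move=> [irr _] lM /flattenP[q /lM[x [y [-> xC yD xy]]]].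
rewrite !inE in xC yD *; have [ux vx] := andP xC; have [yu yv] := andP yD.
have arcN a b : arc a b -> (a != b) && (b != a).
  by move=> ab; rewrite [b == a]eq_sym andbb; apply: contraTneq ab => ->.
have := (arcN _ _ ux, arcN _ _ vx, arcN _ _ yu, arcN _ _ yv).
by case=> [[[/andP[_ h1] /andP[_ h2]] /andP[h3 _]] /andP[h4 _]] /orP[]/eqP->; apply/andP.
Qed.

Lemma indeg_le (T : finType) (arc : rel T) x (Y W : {set T}) :
  (forall y, arc y x -> (y \in Y) || (y \in W)) ->
  indeg arc x <= #|[set y in Y | arc y x]| + #|W|.
Proof.
move=> sub; apply: leq_trans (leq_card_setU _ _); apply: subset_leq_card.
apply/subsetP => y; rewrite !inE => yx; have := sub y yx; rewrite yx.
by case: (y \in Y).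
Qed.

Lemma outdeg_le (T : finType) (arc : rel T) x (Y W : {set T}) :
  (forall y, arc x y -> (y \in Y) || (y \in W)) ->
  outdeg arc x <= #|[set y in Y | arc x y]| + #|W|.
Proof. exact: (indeg_le (arc := converse arc)). Qed.

Lemma path_all (T : eqType) (e : rel T) (P : pred T) x s :
  (forall y z, e y z -> P y -> P z) -> P x -> path e x s -> all P s.
Proof.
move=> eP; elim: s x => //= y s IH x Px /andP[xy ys].
by have Py := eP _ _ xy Px; rewrite Py (IH y).
Qed.

(** * The case of enough links *)

(** The links already serve as interiors, so a single path through all other vertices completes the
    container. *)
Lemma container_with_link (T : finType) (arc : rel T) (a b : T) M z s :
  is_tournament arc -> a != b ->
  links arc (common_out arc a b) (common_in arc a b) M -> uniq (flatten M) ->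
  uniq (z :: s) ->
  (forall x, (x \in z :: s) = [&& x != a, x != b & x \notin flatten M]) ->
  path arc z s -> arc a z -> arc (last z s) b ->
  exists P : 'I_(size M).+1 -> seq T, container_from arc a b P.
Proof.
move=> tour ab lM uM uz memz pz az lb.
apply: (container_of_interiors (Q := (z :: s) :: M)) => //.
- rewrite (_ : flatten _ = (z :: s) ++ flatten M) // cat_uniq uz uM andbT.
  by apply/hasPn => x xM; rewrite /= memz xM !andbF.
- move=> x; rewrite (_ : flatten _ = (z :: s) ++ flatten M) // mem_cat memz.
  case: (boolP (x \in flatten M)) => [xM|_]; last by rewrite andbT orbF.
  by rewrite orbT (links_out tour lM xM).
- move=> q; rewrite inE => /orP[/eqP->|qM]; last exact: links_path qM.
  by split=> //=; rewrite az rcons_path pz.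
Qed.

Lemma container_enough_links (T : finType) (arc : rel T) k t (u v : T) M :
  1 < t -> is_tournament arc -> irregularity_le arc k -> 6 * t + 5 * k <= #|T| ->
  u != v -> links arc (common_out arc u v) (common_in arc u v) M -> uniq (flatten M) ->
  size M < t -> strong_container arc (size M).+1 u v.
Proof.
move=> t1 tour irrk nT uv lM uM mt.
have arcV := tournament_arcVE tour.
have irr := proj1 tour.
pose S := [set z | [&& z != u, z != v & z \notin flatten M]].
have [sM _ _] := links_count (common_disjoint u v tour) lM.
have CS : ~: S = u |: (v |: [set z in flatten M]).
  by apply/setP => z; rewrite !inE !negb_and !negbK.
have cCS : #|~: S| = (size M).*2.+2.
  rewrite CS !cardsU1 !inE (negbTE uv) /= cardsE (card_uniqP uM) sM.
  have -> : u \notin flatten M by apply/negP => /(links_out tour lM); rewrite eqxx.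
  have -> : v \notin flatten M by apply/negP => /(links_out tour lM); rewrite eqxx andbF.
  by [].
have cS : #|S| + (size M).*2.+2 = #|T| by rewrite -cCS cardsC.
have deg x := outdeg_indeg x tour.
have tot x y : x != y -> ~~ arc x y -> arc y x by move=> xy; rewrite (arcV x y xy).
have memS z : z \in S -> (z != u) && (z != v) by rewrite inE => /and3P[-> ->].
have [|||H [uH HS cH]] := camion (e := arc) (S := S).
- by move=> x y _ _ xy; rewrite (arcV x y xy) orbN.
- move=> Y YS Y0; have [YsS [w wS wY]] := properP YS.
  have X0 : S :\: Y != set0 by apply/set0Pn; exists w; rewrite inE wY.
  have cSY : #|Y| + #|S :\: Y| = #|S| by rewrite -(cardsID Y S) (setIidPr YsS).
  have [y0 y0Y lowy] := low_indeg tour Y0.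
  have [x0 x0X lowx] := low_outdeg tour X0.
  case: (boolP [exists x in S :\: Y, [exists y in Y, arc x y]]).
    by case/exists_inP=> x xX /exists_inP[y yY xy]; exists x, y.
  rewrite negb_exists_in => /forall_inP none.
  have noarc x y : x \in S :\: Y -> y \in Y -> ~~ arc x y.
    by move=> /none; rewrite negb_exists_in => /forall_inP h /h.
  have iy : indeg arc y0 <= #|[set y in Y | arc y y0]| + #|~: S|.
    apply: indeg_le => y yy0; case: (boolP (y \in Y)) => //= yY; rewrite inE.
    by apply: contraTN yy0 => yS; apply: noarc; rewrite // inE yY.
  have ox : outdeg arc x0 <= #|[set y in S :\: Y | arc x0 y]| + #|~: S|.
    apply: outdeg_le => y xy; rewrite !in_setD in_setC orbC.
    case: (boolP (y \in S)) => //= yS; rewrite andbT.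
    by apply: contraTN xy => yY; apply: noarc.
  (* The degree bounds add up to [#|T| <= 6 * (size M).+1 + 2 * k], at most [6 * t + 2 * k]. This
     leaves only [k = 0] and [#|T| = 6 * t], but for [k = 0] in-degrees equal out-degrees and [#|T|]
     is odd. *)
  have [i1 i2] := irrk y0; have [i3 i4] := irrk x0.
  have d1 := deg y0; have d2 := deg x0; exfalso.
  move: lowy lowx iy ox i1 i2 i3 i4 d1 d2 cSY cS mt nT; rewrite cCS.
  move: (indeg _ _) (outdeg _ _) (indeg _ _) (outdeg _ _) #|Y| #|S :\: Y| #|S| #|T| (size M).
  by move: #|_| #|_|; clear; lia.
- by move: cS mt nT t1; move: #|S| #|T| (size M); clear; lia.
have small (P : pred T) : {in S, forall z, P z} -> #|P| < #|S| -> False.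
  by move=> SP; rewrite ltnNge => /negP; apply; apply/subset_leq_card/subsetP => z /SP.
(* For an arc from [x] to [y] of the cycle, [e x y] says that cutting there yields neither a path
   from [u] to [v] nor one from [v] to [u]. *)
pose e := [rel x y | arc x y && ((arc u y ==> arc v x) && (arc v y ==> arc u x))].
have useHam a b z s : [|| (a == u) && (b == v) | (a == v) && (b == u)] ->
    path arc z s -> perm_eq (z :: s) H -> arc a z -> arc (last z s) b ->
    strong_container arc (size M).+1 u v.
  move=> hab pz per az lb.
  have uz : uniq (z :: s) by rewrite (perm_uniq per).
  have memz x : (x \in z :: s) = [&& x != u, x != v & x \notin flatten M].
    by rewrite (perm_mem per) HS inE.
  case/orP: hab az lb => /andP[/eqP-> /eqP->] az lb.
    have [P cP] := container_with_link tour uv lM uM uz memz pz az lb.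
    by exists P; left.
  rewrite eq_sym in uv; rewrite common_outC common_inC in lM.
  have [|P cP] := container_with_link tour uv lM uM uz _ pz az lb.
    by move=> x; rewrite memz andbCA.
  by exists P; right.
case: (boolP (cycle e H)) => [cyc|ncyc]; last first.
  have /hasP[x xH nx] : has (fun x => ~~ e x (next H x)) H.
    rewrite has_predC; apply: contra ncyc => /allP al.
    by apply: cycle_from_next.
  have [p [pp lp per]] := cycle_cut uH cH xH.
  have xS : x \in S by rewrite -HS.
  have [xu xv] := andP (memS x xS).
  move: nx; rewrite /= (next_cycle cH xH) /= negb_and !negb_imply.
  case/orP=> /andP[st en].
    by apply: (useHam u v (next H x) p) => //; rewrite ?eqxx // lp arcV 1?eq_sym.
  by apply: (useHam v u (next H x) p) => //; rewrite ?eqxx ?orbT // lp arcV 1?eq_sym.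
have eprop (P : pred T) : (forall y z, e y z -> P y -> P z) ->
    forall x, x \in S -> P x -> {in S, forall z, P z}.
  move=> eP x xS Px z; rewrite -HS => zH; rewrite -HS in xS.
  have [i p ep] := rot_to xS; move: cyc zH; rewrite -(rot_cycle i) -(mem_rot i) ep /=.
  rewrite rcons_path => /andP[pp _]; rewrite inE => /orP[/eqP->//|].
  by apply/allP; exact: path_all eP Px pp.
have degu : (outdeg arc u < #|S|) && (indeg arc u < #|S|).
  have [i1 i2] := irrk u; have d := deg u; move: i1 i2 d cS mt nT.
  by move: (indeg _ _) (outdeg _ _) #|S| #|T| (size M); clear; lia.
(* Along [e], a vertex of D has its successor in D, so all of [S] would dominate [u], against the
   degree of [u]. *)
have noD : {in S, forall x, arc u x || arc v x}.
  move=> x xS; apply: contraT; rewrite negb_or => /andP[nu nv]; exfalso.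
  apply: (@small (fun z => arc z u)) => [z zS|].
  - have [zu zv] := andP (memS z zS).
    have := eprop (fun z => ~~ arc u z && ~~ arc v z) _ x xS _ z zS.
    rewrite nu nv => h; have /andP[nuz _] : ~~ arc u z && ~~ arc v z.
      apply: h => // a b /and3P[_ h1 h2] /andP[ua va].
      by move: h1 h2; rewrite (negbTE ua) (negbTE va); do 2!case: (arc _ b).
    by apply: tot; rewrite // eq_sym.
  - by case/andP: degu => _; apply: leq_ltn_trans; apply: eq_leq; apply: eq_card => z; rewrite inE.
(* Along [e], a vertex outside C has its successor outside C. So one vertex of C in [S] puts all of
   [S] in C, again too many for the degree of [u]. *)
have noC : {in S, forall x, ~~ (arc u x && arc v x)}.
  move=> x xS; apply/negP => Cx; apply: (@small (fun z => arc u z)) => [z zS|].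
    apply: contraT => nuz; have : {in S, forall z, ~~ (arc u z && arc v z)}.
      apply: (eprop (fun z => ~~ (arc u z && arc v z)) _ z) => //; last by rewrite (negbTE nuz).
      move=> a b /and3P[_ h1 h2]; apply: contraNN => /andP[ub vb].
      by rewrite ub vb /= in h1 h2; rewrite h1 h2.
    by move=> /(_ x xS); rewrite Cx.
  by case/andP: degu => + _; apply: leq_ltn_trans; apply: eq_leq; apply: eq_card => z; rewrite inE.
(* Now [S] lies in A and B, and [e] makes the cycle alternate between them, with [arc u] as the
   colour. *)
have vE : {in S, forall x, arc v x = ~~ arc u x}.
  by move=> x xS; move: (noD x xS) (noC x xS); case: (arc u x) (arc v x) => [] [].
have sH : size H = #|S| by rewrite -(card_uniqP uH); apply: eq_card.
have [||x xH|z [s [pz per col]]] :=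
    alternating_cycle (e := arc) (col := arc u) (s := H) irr tot uH.
- by rewrite sH; move: cS mt nT t1; move: #|S| #|T| (size M); clear; lia.
- apply: (sub_in_cycle (P := mem S)) cyc => [x y xS yS /and3P[xy]|].
    by rewrite /= xy !vE //; case: (arc u x) (arc u y) => [] [].
  by apply/allP => x; rewrite HS.
- have xS : x \in S by rewrite -HS.
  have -> : count (arc x) H = #|[set y in S | arc x y]|.
    by rewrite -(card_set_count (arc x) uH); apply: eq_card => y; rewrite !inE HS inE.
  (* Each vertex of [S] misses an arc to [u] or to [v]. This saves one: the out-degree is at least
     [3 * t], of which at most [(size M).*2.+1] leaves [S], so at least [t.+1 >= 3] remains. *)
  have [a aS nxa] : exists2 a, a \in ~: S & ~~ arc x a.
    have [xu xv] := andP (memS x xS).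
    case: (boolP (arc u x)) => ux.
      by exists u; [rewrite !inE eqxx | rewrite arcV 1?eq_sym // ux].
    by exists v; [rewrite !inE eqxx andbF | rewrite arcV 1?eq_sym // vE // ux].
  have ox : outdeg arc x <= #|[set y in S | arc x y]| + #|~: S :\ a|.
    apply: outdeg_le => y xy; rewrite in_setD1 in_setC.
    by case: (y \in S); rewrite ?andbT //=; apply: contraNneq nxa => <-.
  have := cardsD1 a (~: S); rewrite aS cCS => cW.
  have [i1 i2] := irrk x; have d := deg x.
  move: ox i1 i2 d cS mt nT t1 cW; move: #|_| #|_| (indeg _ _) (outdeg _ _) #|S| #|T| (size M).
  by clear; lia.
- have zS : z \in S by rewrite -HS -(perm_mem per) mem_head.
  have lS : last z s \in S by rewrite -HS -(perm_mem per) mem_last.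
  have [lu lv] := andP (memS _ lS).
  case: (boolP (arc u z)) => uz.
    apply: (useHam u v z s) => //; rewrite ?eqxx //.
    by rewrite arcV 1?eq_sym // vE // -col uz.
  apply: (useHam v u z s) => //; rewrite ?eqxx ?orbT //; first by rewrite vE.
  by rewrite arcV 1?eq_sym // -col uz.
Qed.

(** * The case of few links *)

(* For the set Y of vertices at which a path from [a] cannot enter G; the vertices at which a
   path to [b] cannot leave G are handled by the converse tournament. *)
Lemma arc_into_bad_set (T : finType) (arc : rel T) k t m (a b : T) (A F G Y : {set T}) :
  is_tournament arc -> irregularity_le arc k -> 6 * t + 5 * k <= #|T| -> m.+2 <= t ->
  (forall z, z \in G = [&& z != a, z != b, z \notin F & z \notin A]) ->
  #|F| = m.*2 -> m <= #|[set z in F | arc z a]| ->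
  Y \subset G -> Y != set0 ->
  {in Y, forall y, arc y a} -> {in Y, forall y, #|[set x in A | arc x y]| <= 1} ->
  exists x y, [/\ x \in G :\: Y, y \in Y & arc x y].
Proof.
move=> tour irrk nT mt GE cF cFa YG Y0 Ya YA.
case: (boolP [exists x in G :\: Y, [exists y in Y, arc x y]]).
  by case/exists_inP=> x xX /exists_inP[y yY xy]; exists x, y.
rewrite negb_exists_in => /forall_inP none; exfalso.
have [y yY lowy] := low_indeg tour Y0.
have iy : indeg arc y <= #|[set x in Y | arc x y]| + #|b |: (F :|: [set x in A | arc x y])|.
  apply: indeg_le => x xy; case: (boolP (x \in Y)) => //= xY; rewrite !inE xy andbT.
  have nxG : x \notin G.
    apply: contraTN xy => xG; have := none x; rewrite inE xY xG => /(_ isT).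
    by rewrite negb_exists_in => /forall_inP /(_ y yY).
  have xa : x != a.
    apply: contraTneq xy => ->; rewrite (tournament_arcVE tour) ?Ya //.
    by apply: contraTneq (Ya y yY) => ->; rewrite (negbTE (proj1 tour a)).
  by move: nxG; rewrite GE xa /= !negb_and !negbK.
have cW : #|b |: (F :|: [set x in A | arc x y])| <= m.*2.+2.
  have := YA y yY; have [+ _] := leq_card_setU F [set x in A | arc x y].
  rewrite cardsU1 cF; move: #|_| #|_| (_ \notin _) => p q [] /=; clear; lia.
have cY : #|Y| + m <= indeg arc a.
  apply: leq_trans (leq_add (leqnn _) cFa) _; rewrite -cardsUI.
  rewrite (_ : _ :&: _ = set0) ?cards0 ?addn0.
    apply/subset_leq_card/subsetP => x; rewrite !inE => /orP[/Ya->//|/andP[_ ->//]].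
  apply/setP => x; rewrite !inE; apply/negP => /andP[/(subsetP YG)].
  by rewrite GE => /and4P[_ _ /negbTE->].
(* The bounds combine to [#|T| <= 6 * m + 3 * k + 7], contradicting [m.+2 <= t]. *)
have [i1 i2] := irrk y; have [i3 i4] := irrk a.
have d1 := outdeg_indeg y tour; have d2 := outdeg_indeg a tour.
move: lowy iy cW cY i1 i2 i3 i4 d1 d2 nT mt.
move: #|_| #|_| #|_| (indeg _ _) (outdeg _ _) (indeg _ _) (outdeg _ _) #|T|; clear; lia.
Qed.

Lemma links_mem (T : finType) (arc : rel T) C D M z :
  links arc C D M -> z \in flatten M -> (z \in C) || (z \in D).
Proof.
move=> lM /flattenP[q /lM[x [y [-> xC yD _]]]]; rewrite !inE.
by case/orP=> /eqP->; rewrite ?xC ?yD ?orbT.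
Qed.

Lemma exists_notin (T : finType) (X : {set T}) (s : seq T) :
  size s < #|X| -> exists2 x, x \in X & x \notin s.
Proof.
move=> sX; apply/exists_inP; apply: contraTT sX; rewrite negb_exists_in => /forall_inP h.
rewrite -leqNgt; apply: leq_trans (card_size s); apply/subset_leq_card/subsetP => x xX.
by have := h x xX; rewrite negbK.
Qed.

(** The paths run from [a] to [b] because A is at least as large as B and has to supply the missing
    interiors. *)
Lemma container_few_links (T : finType) (arc : rel T) k t w (a b : T) M :
  is_tournament arc -> irregularity_le arc k -> 6 * t + 5 * k <= #|T| ->
  a != b -> links arc (common_out arc a b) (common_in arc a b) M -> uniq (flatten M) ->
  (forall x y, x \in common_out arc a b -> y \in common_in arc a b ->
     x \notin flatten M -> y \notin flatten M -> ~~ arc x y) ->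
  #|between arc b a| <= #|between arc a b| ->
  (size M).+1 < w <= t ->
  exists P : 'I_w -> seq T, container_from arc a b P.
Proof.
move=> tour irrk nT ab lM uM maxM BA /andP[mw wt].
have irr := proj1 tour; have arcV := tournament_arcVE tour.
have neq x y : arc x y -> x != y by apply: contraTneq => ->.
have asym x y : arc x y -> arc y x = false.
  by move=> xy; rewrite (arcV x y (neq _ _ xy)) xy.
have tot x y : x != y -> ~~ arc x y -> arc y x by move=> xy; rewrite (arcV x y xy).
set C := common_out arc a b in lM maxM; set D := common_in arc a b in lM maxM.
set A := between arc a b in BA *; set B := between arc b a in BA.
have [sM cM dM] := links_count (common_disjoint a b tour) lM.
rewrite -/C -/D in cM dM.
pose F := [set z in flatten M].
have cF : #|F| = (size M).*2 by rewrite cardsE (card_uniqP uM).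
have cFC : #|[set z in F | z \in C]| = size M.
  by rewrite -cM -(card_set_count _ uM); apply: eq_card => z; rewrite !inE.
have cFD : #|[set z in F | z \in D]| = size M.
  by rewrite -dM -(card_set_count _ uM); apply: eq_card => z; rewrite !inE.
have AF z : z \in A -> z \notin F.
  rewrite !inE => /andP[az zb]; apply/negP => /(links_mem lM); rewrite !inE.
  by rewrite (asym _ _ az) (asym _ _ zb) andbF.
have Aab z : z \in A -> (z != a) && (z != b).
  by rewrite inE => /andP[/neq + /neq ->]; rewrite eq_sym => ->.
have cAC : #|A| + #|C| <= outdeg arc a.
  rewrite -cardsUI (_ : A :&: C = set0) ?cards0 ?addn0.
    by apply/subset_leq_card/subsetP => z; rewrite !inE => /orP[]/andP[->].
  apply/setP => z; rewrite !inE; apply/negP => /andP[/andP[_ zb] /andP[_]].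
  by rewrite (asym _ _ zb).
have cBC : #|B| + #|C| <= outdeg arc b.
  rewrite -cardsUI (_ : B :&: C = set0) ?cards0 ?addn0.
    by apply/subset_leq_card/subsetP => z; rewrite !inE => /orP[]/andP[] // _ ->.
  apply/setP => z; rewrite !inE; apply/negP => /andP[/andP[_ za] /andP[]].
  by rewrite (asym _ _ za).
have [ia1 ia2] := irrk a; have da := outdeg_indeg a tour.
have [ib1 ib2] := irrk b; have db := outdeg_indeg b tour.
(* A must supply [w - (size M).+1] interiors and up to two vertices joining the long path to [a] and
   [b]. *)
have cA : w < #|A| + size M.
  pose C' := C :\: F.
  have cC' : #|C'| + size M = #|C|.
    rewrite -cFC -(cardsID F C) addnC; congr (_ + _).
    by apply: eq_card => z; rewrite !inE andbC.
  (* If the links use up C, the out-neighbours of [a] lie in A, among the [size M] vertices of C, or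
     at [b]. *)
  case: (eqVneq C' set0) => [C0|C0].
    have : outdeg arc a <= #|[set y in A | arc a y]| + #|b |: C|.
      apply: outdeg_le => y ay; rewrite !inE ay /= orbC.
      by case: (eqVneq y b) => //= yb; rewrite (arcV y b yb) orNb.
    have : #|[set y in A | arc a y]| <= #|A|.
      by apply/subset_leq_card/subsetP => y; rewrite inE => /andP[].
    have : #|b |: C| <= (#|C|).+1 by rewrite cardsU1 -add1n leq_add2r leq_b1.
    move: cC'; rewrite C0 cards0 => <-; move: ia1 ia2 da nT mw wt.
    move: #|_| #|_| #|_| (outdeg _ _) (indeg _ _) #|T| (size M); clear; lia.
  (* By maximality [x] dominates no vertex of D off the links, so its out-neighbours lie in [C'],
     [F], A or B. With few of them in [C'], this gives [#|T| < 6 * (#|A| + size M) + 3 * k]. *)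
  have [x xC' lowx] := low_outdeg tour C0.
  have [ix1 ix2] := irrk x; have dx := outdeg_indeg x tour.
  have [xF xC] : x \notin F /\ x \in C by move: xC'; rewrite inE => /andP.
  have [ax bx] : arc a x /\ arc b x by move: xC; rewrite inE => /andP.
  have : outdeg arc x <= #|[set y in C' | arc x y]| + #|F :|: (A :|: B)|.
    apply: outdeg_le => y xy.
    have ya : y != a by apply: contraTneq xy => ->; rewrite (asym _ _ ax).
    have yb : y != b by apply: contraTneq xy => ->; rewrite (asym _ _ bx).
    rewrite in_setD in_setU; case: (boolP (y \in F)) => //= yF.
    have yD : y \notin D.
      by apply: contraTN xy => yD; apply: maxM => //; [move: xF | move: yF]; rewrite inE.
    move: yD; rewrite !inE (arcV y a ya) (arcV y b yb).
    by case: (arc y a) (arc y b) => [] [].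
  have [+ _] := leq_card_setU F (A :|: B); have [+ _] := leq_card_setU A B.
  move: lowx cF cC' cAC cBC ix1 ix2 dx ia1 ia2 da ib1 ib2 db nT mw wt BA.
  move: #|F :|: _| #|F| #|_ :|: _| #|C'| #|C| #|_| #|B| #|A| (size M).
  move: (indeg _ _) (outdeg _ _) (indeg _ _) (outdeg _ _) (indeg _ _) (outdeg _ _) #|T|.
  clear; lia.
pose G := [set z | [&& z != a, z != b, z \notin F & z \notin A]].
have GE z : z \in G = [&& z != a, z != b, z \notin F & z \notin A] by rewrite [LHS]inE.
have G0 : G != set0.
  rewrite -card_gt0; have := cardsC G.
  rewrite (_ : ~: G = a |: (b |: (F :|: A))); last first.
    by apply/setP => z; rewrite in_setC GE !negb_and !negbK in_setU1 in_setU1 in_setU.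
  have [+ _] := leq_card_setU F A; rewrite !cardsU1 cF.
  move: (_ \notin _ : bool) (_ \notin _ : bool) => p q; move: cAC ia1 ia2 da nT mw wt.
  move: #|_ :|: _| #|A| #|G| #|C| (size M) (outdeg _ _) (indeg _ _) #|T|.
  by clear; case: p; case: q => /=; lia.
(* Two neighbours in A are required so that the vertices of A chosen before and after the
   path can be distinct. *)
pose st z := (z \in C) || (1 < #|[set x in A | arc x z]|).
pose en z := (z \in D) || (1 < #|[set x in A | arc z x]|).
have [||x xG|Y YG Y0 Yst|Y YG Y0 Yen|z [s [uz zsG pz stz enz]]] :=
    hamiltonian_path_between (e := arc) (u := a) (st := st) (en := en) _ G0.
- by rewrite GE eqxx.
- by move=> x y _ _ xy; rewrite (arcV x y xy) orbN.
(* A has at least three vertices, so [x] has two in-neighbours or two out-neighbours there. *)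
- have xA : x \notin A by move: xG; rewrite GE => /and4P[].
  have : #|A| <= #|[set y in A | arc y x]| + #|[set y in A | arc x y]|.
    have [+ _] := leq_card_setU [set y in A | arc y x] [set y in A | arc x y].
    apply: leq_trans; apply/subset_leq_card/subsetP => y yA; rewrite !inE -!andb_orr.
    rewrite inE in yA; rewrite yA /= (arcV x y) ?orNb //.
    by apply: contraNneq xA => ->; rewrite inE.
  rewrite /st /en; case: (x \in C) (x \in D) => [] [] //=; move: cA mw; clear; lia.
- apply: (arc_into_bad_set tour irrk nT _ GE cF _ YG Y0); first by lia.
  + rewrite -cFD; apply/subset_leq_card/subsetP => x; rewrite !inE.
    by case/andP=> -> /andP[->].
  + move=> y yY; have := Yst y yY; rewrite negb_or => /andP[yC _].
    have := subsetP YG y yY; rewrite GE => /and4P[ya yb _ yA].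
    move: yC yA; rewrite !inE (arcV y a ya) (arcV y b yb).
    by case: (arc y a) (arc y b) => [] [].
  + by move=> y yY; have := Yst y yY; rewrite negb_or -leqNgt => /andP[].
- have irrk' : irregularity_le (converse arc) k by move=> x; have [] := irrk x.
  have GE' z : z \in G = [&& z != b, z != a, z \notin F & z \notin A] by rewrite GE andbCA.
  have [||||x [y [xGY yY xy]]] := arc_into_bad_set (a := b) (tournament_converse tour)
    irrk' nT _ GE' cF _ YG Y0.
  + by lia.
  + rewrite -cFC; apply/subset_leq_card/subsetP => x; rewrite !inE.
    by rewrite /converse => /andP[-> /andP[_ ->]].
  + move=> y yY; have := Yen y yY; rewrite negb_or => /andP[yD _].
    have := subsetP YG y yY; rewrite GE => /and4P[ya yb _ yA].
    move: yD yA; rewrite !inE /converse; rewrite eq_sym in ya; rewrite eq_sym in yb.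
    by rewrite (arcV a y ya) (arcV b y yb); case: (arc a y) (arc b y) => [] [].
  + by move=> y yY; have := Yen y yY; rewrite negb_or -leqNgt => /andP[].
  + by exists y, x.
have lG : last z s \in G by rewrite -zsG mem_last.
have sG x : x \in z :: s -> x \notin A by rewrite zsG GE => /and4P[].
have [pre [spre preA paz]] : exists pre, [/\ size pre <= 1, {subset pre <= A}
    & path arc a (pre ++ z :: s)].
  move: stz; rewrite /st; case: (boolP (z \in C)) => [zC _|_ /= /ltnW /card_gt0P[x]].
    by exists [::]; split=> //=; move: zC; rewrite pz inE => /andP[->].
  rewrite inE => /andP[xA xz]; exists [:: x]; split=> //=.
    by move=> y; rewrite inE => /eqP->.
  by rewrite xz pz; move: xA; rewrite inE => /andP[->].
have [post [spost postA upost pzb]] : exists post, [/\ size post <= 1, {subset post <= A},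
    uniq (pre ++ post) & path arc (last z s) (rcons post b)].
  have upre : uniq pre by case: (pre) spre => [|? []].
  move: enz; rewrite /en; case: (boolP (last z s \in D)) => [zD _|_ /= gt1].
    exists [::]; split; rewrite ?cats0 //=; move: zD; rewrite inE => /andP[_ ->] //.
  have [x] := exists_notin (leq_ltn_trans spre gt1).
  rewrite inE => /andP[xA xz] xpre; exists [:: x]; split=> //=.
  + by move=> y; rewrite inE => /eqP->.
  + by rewrite cats1 rcons_uniq xpre.
  + by rewrite xz; move: xA; rewrite inE => /andP[_ ->].
pose A1 := [set x in A | x \notin pre ++ post].
have [s1 [us1 s1A ss1]] := redei A1 tour.
have cA1 : w - (size M).+1 <= size s1.
  have : #|A| <= size s1 + size (pre ++ post).
    have <- : size (s1 ++ (pre ++ post)) = size s1 + size (pre ++ post) by rewrite size_cat.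
    apply: leq_trans (card_size _); apply/subset_leq_card/subsetP => x xA.
    by rewrite mem_cat s1A in_set xA /=; case: (x \in _).
  by rewrite size_cat; move: spre spost cA; clear; lia.
have [||Q1 [sQ1 fQ1 pQ1]] := @split_path T arc a b (w - (size M).+1) s1 ss1.
- by move=> x; rewrite s1A in_set => /andP[]; rewrite inE => /andP[].
- by rewrite cA1 subn_gt0 mw.
set q := pre ++ (z :: s) ++ post.
(* One long interior, [w - (size M).+1] pieces of A, and the links: [w] in all. *)
pose Q := q :: Q1 ++ M.
have sQ : size Q = w by rewrite /= size_cat sQ1; move: mw; clear; lia.
have fQ : flatten Q = q ++ s1 ++ flatten M by rewrite /= flatten_cat fQ1.
have qE x : x \in q = (x \in pre ++ post) || (x \in G).
  by rewrite /q !mem_cat zsG -orbA [(x \in G) || _]orbC.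
have prepostA x : x \in pre ++ post -> x \in A.
  by rewrite mem_cat => /orP[/preA|/postA].
rewrite -sQ; apply: container_of_interiors => //.
- rewrite fQ cat_uniq; apply/and3P; split.
  + rewrite /q uniq_catCA cat_uniq uz upost andbT.
    by apply/hasPn => x /prepostA xA; apply/negP => /sG; rewrite xA.
  + apply/hasPn => x; rewrite mem_cat /= qE negb_or s1A in_set => /orP[/andP[xA ->]|xM].
      by rewrite GE xA !andbF.
    rewrite GE inE xM !andbF andbT; apply/negP => /prepostA /AF; rewrite inE xM //.
  + rewrite cat_uniq us1 uM andbT; apply/hasPn => x xM; rewrite /= s1A in_set.
    by apply/negP => /andP[/AF]; rewrite inE xM.
- move=> x; rewrite fQ mem_cat qE GE [x \in s1 ++ _]mem_cat s1A [x \in A1]in_set.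
  case: (boolP (x \in A)) => [xA|xA].
    by rewrite (Aab _ xA) !andbF orbF; case: (x \in pre ++ post).
  rewrite (negbTE (contra (@prepostA x) xA)) andbT /= inE.
  case: (boolP (x \in flatten M)) => [xM|_]; last by rewrite andbT orbF.
  by rewrite orbT (links_out tour lM xM).
- move=> r; rewrite inE mem_cat => /or3P[/eqP->|/pQ1//|rM]; last exact: links_path rM.
  split; first by rewrite /q; case: (pre).
  by rewrite /q catA rcons_cat cat_path paz last_cat.
Qed.

(** * Choice of the number of links and of the direction *)

Theorem theorem4p2 (k t : nat) (T : finType) (arc : rel T) :
  2 <= t ->
  is_tournament arc ->
  irregularity_le arc k ->
  6 * t + 5 * k <= #|T| ->
  forall w, 1 <= w <= t -> k_strongly_connected arc w.
Proof.
move=> t2 tour irrk nT w /andP[w1 wt] u v uv.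
(* One of the [w] paths is kept for the vertices off the links. *)
have [M [lM uM sM maxM]] := exists_links arc w.-1 (common_disjoint u v tour).
case: (ltnP (size M) w.-1) => [mw|wm].
  have {}maxM : forall x y, x \in common_out arc u v -> y \in common_in arc u v ->
      x \notin flatten M -> y \notin flatten M -> ~~ arc x y.
    by case: maxM => // smw; rewrite smw ltnn in mw.
  have mwt : (size M).+1 < w <= t by rewrite wt andbT -(prednK w1) ltnS.
  (* The larger of A and B fixes the direction; links are symmetric in [u] and [v]. *)
  case: (leqP #|between arc v u| #|between arc u v|) => [le|/ltnW le].
    have [P cP] := container_few_links tour irrk nT uv lM uM maxM le mwt.
    by exists P; left.
  rewrite eq_sym in uv; rewrite common_outC common_inC in lM maxM.
  have [P cP] := container_few_links tour irrk nT uv lM uM maxM le mwt.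
  by exists P; right.
have sMw : (size M).+1 = w by rewrite (anti_leq (introT andP (conj sM wm))) prednK.
rewrite -sMw; apply: (container_enough_links t2 tour irrk nT uv lM uM).
by rewrite sMw.
Qed.
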